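(* Let $1\le k\le n$ and $I_k^+=\{(j_1,\dots,j_k)\in\{1,\dots,n\}^k : n\ge j_1>\dots>j_k\ge 1\}$. Then for all $i\in\{1,\dots,n\}$, $$\hat Q_k(\lambda_i)=\sum_{(j_1,\dots,j_k)\in I_k^+}\left[\frac{\hat p_{j_1}^2\cdots\hat p_{j_k}^2\,\lambda_{j_1}^2\cdots\lambda_{j_k}^2\,V(\lambda_{j_1},\dots,\lambda_{j_k})^2}{\sum_{(j_1,\dots,j_k)\in I_k^+}\hat p_{j_1}^2\cdots\hat p_{j_k}^2\,\lambda_{j_1}^2\cdots\lambda_{j_k}^2\,V(\lambda_{j_1},\dots,\lambda_{j_k})^2}\right]\prod_{l=1}^k\left(1-\frac{\lambda_i}{\lambda_{j_l}}\right),$$ where $\hat p_i:=p_i+\tilde\varepsilon_i$ with $p_i:=(X\beta^* )^Tu_i=\sqrt{\lambda_i}\,\tilde\beta^*_i$ and $\tilde\varepsilon_i:=\varepsilon^Tu_i$.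
   Context: Setting: $n\le p$ are positive integers, $X\in\mathbb{R}^{n\times p}$, $\beta^*\in\mathbb{R}^p$, $\varepsilon\in\mathbb{R}^n$, and $Y=X\beta^*+\varepsilon\in\mathbb{R}^n$. The matrix $X$ has rank $n$, and $\lambda_1\ge\dots\ge\lambda_n>0$ are the eigenvalues of $XX^T$. From the singular value decomposition of $X$, $u_1,\dots,u_n$ is an orthonormal basis of $\mathbb{R}^n$ and $v_1,\dots,v_p$ is an orthonormal basis of $\mathbb{R}^p$ with $Xv_i=\sqrt{\lambda_i}u_i$ and $X^Tu_i=\sqrt{\lambda_i}v_i$ for $1\le i\le n$, and $Xv_i=0$ for $i>n$. Put $\tilde\beta^*_i:=(\beta^* )^Tv_i$. $\|\cdot\|$ is the Euclidean norm. Krylov subspace: $\mathcal{K}^k=\mathrm{span}\{X^TY,(X^TX)X^TY,\dots,(X^TX)^{k-1}X^TY\}$. Standing assumption: $\dim\mathcal{K}^k=k$ for the value of $k$ considered. PLS estimator: $\hat\beta_k=\mathrm{argmin}_{\beta\in\mathcal{K}^k}\|Y-X\beta\|^2$. It is written $\hat\beta_k=\hat P_k(X^TX)X^TY$, where $\hat P_k$ is the (unique) polynomial of degree at most $k-1$ minimizing $\|Y-XP(X^TX)X^TY\|^2$ over polynomials $P$ of degree at most $k-1$. The residual polynomial is $\hat Q_k(t)=1-t\hat P_k(t)$. $V(x_1,\dots,x_l)=\prod_{1\le q<m\le l}(x_m-x_q)$ denotes the Vandermonde determinant. *)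

(* Defs.v *)
From mathcomp Require Import all_boot all_order all_algebra.

Set Implicit Arguments.
Unset Strict Implicit.
Unset Printing Implicit Defensive.

Import Order.TTheory GRing.Theory Num.Theory.
Local Open Scope ring_scope.

Definition dotv (R : rcfType) (m : nat) (x y : 'cV[R]_m) : R :=
  (x^T *m y) 0 0.

Definition enorm (R : rcfType) (m : nat) (x : 'cV[R]_m) : R :=
  Num.sqrt (dotv x x).

Definition orthonormal_basis (R : rcfType) (m : nat) (e : 'I_m -> 'cV[R]_m) :
    Prop :=
  (forall i j : 'I_m, dotv (e i) (e j) = (i == j)%:R) /\
  basis_of fullv [seq e i | i : 'I_m].

(* The column dimension has the form p'.+1 so that 'M_(p'.+1) is a nontrivial
   ring and [horner_mx] applies. *)
Definition krylov (R : rcfType) (n p' : nat) (X : 'M[R]_(n, p'.+1))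
    (Y : 'cV[R]_n) (k : nat) : {vspace 'cV[R]_(p'.+1)} :=
  <<[seq (X^T *m X) ^+ m *m (X^T *m Y) | m <- iota 0 k]>>%VS.

Definition pls_objective (R : rcfType) (n p' : nat) (X : 'M[R]_(n, p'.+1))
    (Y : 'cV[R]_n) (P : {poly R}) : R :=
  enorm (Y - X *m (horner_mx (X^T *m X) P *m (X^T *m Y))) ^+ 2.

(* [size P <= k] means degree at most k - 1. *)
Definition is_pls_poly (R : rcfType) (n p' : nat) (X : 'M[R]_(n, p'.+1))
    (Y : 'cV[R]_n) (k : nat) (P : {poly R}) : Prop :=
  (size P <= k)%N /\
  forall P' : {poly R}, (size P' <= k)%N ->
    pls_objective X Y P <= pls_objective X Y P'.

Definition residual_poly (R : rcfType) (P : {poly R}) : {poly R} :=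
  1 - 'X * P.

Definition vandermonde (R : rcfType) (l : nat) (x : 'I_l -> R) : R :=
  \prod_(q < l) \prod_(m < l | (q < m)%N) (x m - x q).

Definition Iplus (n k : nat) : {set {ffun 'I_k -> 'I_n}} :=
  [set j : {ffun 'I_k -> 'I_n} |
    [forall a : 'I_k, forall b : 'I_k, (a < b)%N ==> (j b < j a)%N]].

Definition pls_weight (R : rcfType) (n k : nat) (phat lambda : 'I_n -> R)
    (j : {ffun 'I_k -> 'I_n}) : R :=
  (\prod_(l < k) phat (j l) ^+ 2) * (\prod_(l < k) lambda (j l) ^+ 2) *
  vandermonde (fun l : 'I_k => lambda (j l)) ^+ 2.

(* Main.v *)
Require Import Defs.
From mathcomp Require Import all_boot all_order all_algebra.
From mathcomp Require Import all_fingroup.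
From mathcomp Require Import ring lra zify.

(** The singular value decomposition turns the least-squares problem defining
    the PLS polynomial into a weighted one at the points lambda_i
    ([pls_objective_spectral]): minimize the sum of w_i Q(lambda_i)^2 over the
    polynomials Q(t) = 1 - t P(t) with deg P < k, where w_i is the square of
    the coordinate of Y along u_i, that is of p_i + eps_i. The minimizer is
    characterized by normal equations: Q is orthogonal to t, ..., t^k for the
    weights w_i ([least_squares_normal]).

    These equations are linear in the coefficients of P, with matrix
    M_(a,b) = sum_i w_i lambda_i^(a+b+2). A determinant manipulation in the
    spirit of Cramer's rule ([residual_mul_det]) gives, for every t,

      Q(t) * det M = det (sum_i w_i lambda_i (lambda_i - t) lambda_i^(a+b))_(a,b).

    Both determinants are those of moment matrices of discrete measures, which
    the Cauchy-Binet formula expands over the strictly decreasing index tuples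
    into products of masses times squared Vandermonde determinants
    ([cauchy_binet], [det_moment_mx]). The term of index j on the right is the
    corresponding term of det M multiplied by the product of the
    1 - t / lambda_(j_l), so dividing by det M yields the stated weighted
    average at t = lambda_i. The division is legitimate because a kernel vector
    of M would be a linear relation between the k Krylov vectors
    ([krylov_moment_det_neq0]). *)

Set Implicit Arguments.
Unset Strict Implicit.
Unset Printing Implicit Defensive.

Import Order.TTheory GRing.Theory Num.Theory.
Local Open Scope ring_scope.

(** * Strictly decreasing index tuples and the Cauchy-Binet formula *)

(** Turns the pointwise condition defining [Iplus] into sortedness of a list of
    naturals, so that the uniqueness and existence of sorted rearrangements
    apply. *)
Lemma Iplus_sortedE n k (j : {ffun 'I_k -> 'I_n}) :
  (j \in Iplus n k) = sorted gtn [seq val i | i <- codom j].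
Proof.
have tr : transitive gtn by move=> b a c /= ba cb; apply: ltn_trans cb ba.
have nthE x0 (a : 'I_k) : nth x0 [seq val i | i <- codom j] a = j a.
  by rewrite -map_comp (nth_map a) ?size_enum_ord // nth_ord_enum.
rewrite inE; apply/forallP/idP => [jP | srt a].
  rewrite -map_comp sorted_map.
  apply: (@sub_sorted _ (relpre val ltn)) => [a b /= ab|].
    by have /forallP/(_ b)/implyP := jP a; apply.
  by rewrite -sorted_map val_enum_ord iota_ltn_sorted.
apply/forallP => b; apply/implyP => ab.
have := sorted_ltn_nth tr 0%N srt a b; rewrite !inE !nthE; apply=> //.
all: by rewrite size_map size_codom card_ord.
Qed.

Lemma Iplus_inj n k (j : {ffun 'I_k -> 'I_n}) :
  j \in Iplus n k -> injective j.
Proof.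
rewrite Iplus_sortedE gtn_sorted_uniq_geq => /andP[+ _].
by rewrite (map_inj_uniq val_inj) => /injectiveP.
Qed.

(** Every injective index tuple is uniquely a strictly decreasing one followed by
    a permutation; [comp_perm] is that parametrization, and the next two lemmas
    are its surjectivity and injectivity. *)
Definition comp_perm n k (js : {ffun 'I_k -> 'I_n} * 'S_k) :=
  [ffun l => js.1 (js.2 l)].

Lemma injective_Iplus_perm n k :
  [set f : {ffun 'I_k -> 'I_n} | injectiveb f] =
  @comp_perm n k @: setX (Iplus n k) [set: 'S_k].
Proof.
apply/setP => f; rewrite inE; apply/idP/imsetP => [finj | [[j s]]]; last first.
  case/setXP => /= /Iplus_inj jinj _ ->; apply/injectiveP => a b.
  by rewrite !ffunE => /jinj/perm_inj.
(* The decreasing tuple is the sorted list of values of f, and the permutation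
   is the one that undoes the sorting. *)
pose T := sort (relpre val geq) (codom f).
have szT : size T == k by rewrite size_sort size_codom card_ord.
have szf : size (codom f) == k by rewrite size_codom card_ord.
have permT : perm_eq (Tuple szf) (Tuple szT) by rewrite perm_sym perm_sort.
have /tuple_permP[s fE] := permT.
pose j := [ffun l => tnth (Tuple szT) l].
have codomT : codom j = T.
  by rewrite /codom /image_mem (eq_map (ffunE _)) map_tnth_enum.
exists (j, s).
  apply/setXP; split; last by rewrite inE.
  rewrite /= Iplus_sortedE codomT gtn_sorted_uniq_geq.
  rewrite (map_inj_uniq val_inj) sort_uniq -[uniq _]/(injectiveb f) finj /=.
  by rewrite sorted_map sort_sorted // => a b; apply: leq_total.
apply/ffunP => l; rewrite !ffunE /=.
rewrite -[RHS](tnth_mktuple (fun i => tnth (Tuple szT) (s i))).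
move/val_inj: fE => <-.
by rewrite (tnth_nth (f l)) /= (nth_map l) ?size_enum_ord // nth_ord_enum.
Qed.

Lemma Iplus_perm_inj n k :
  {in setX (Iplus n k) [set: 'S_k] &, injective (@comp_perm n k)}.
Proof.
case=> [j s] [j' s'] /setXP[/= jI _] /setXP[/= j'I _] /ffunP E.
(* Both tuples are strictly decreasing lists with the same set of values. *)
have jj' : j = j'.
  have imE : codom j =i codom j'.
    move=> x; apply/codomP/codomP => -[a ->].
      exists (s' ((s^-1)%g a)); have := E ((s^-1)%g a).
      by rewrite !ffunE /= permKV.
    exists (s ((s'^-1)%g a)); have := E ((s'^-1)%g a).
    by rewrite !ffunE /= permKV.
  move: (jI) (j'I); rewrite !Iplus_sortedE => jS j'S.
  have tr : transitive gtn by move=> b a c /= ba cb; apply: ltn_trans cb ba.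
  have : codom j = codom j'.
    apply: (inj_map val_inj).
    apply: (irr_sorted_eq tr) jS j'S _ => [a|x]; first exact: ltnn.
    exact: (eq_mem_map val imE).
  rewrite !codom_ffun => /val_inj E'.
  by rewrite -[j]fgraphK E' fgraphK.
congr (_, _) => //; apply/permP => l; have := E l.
by rewrite !ffunE /= jj' => /(Iplus_inj j'I).
Qed.

(** Multilinearity of the determinant in the rows of [A *m B], each of which is a
    linear combination of rows of [B]. *)
Lemma det_mulmx_sum (R : comPzRingType) n k (A : 'M[R]_(k, n)) (B : 'M[R]_(n, k)) :
  \det (A *m B) =
  \sum_(f : {ffun 'I_k -> 'I_n}) (\prod_i A i (f i)) * \det (rowsub f B).
Proof.
transitivity (\sum_(s : 'S_k) (-1) ^+ s *
    \sum_(f : {ffun 'I_k -> 'I_n}) \prod_i (A i (f i) * B (f i) (s i))).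
  apply: eq_bigr => s _; congr (_ * _).
  rewrite -(bigA_distr_bigA (fun i l => A i l * B l (s i))) /=.
  by apply: eq_bigr => i _; rewrite mxE.
under eq_bigr do rewrite big_distrr /=.
rewrite exchange_big /=; apply: eq_bigr => f _.
rewrite /determinant mulr_sumr; apply: eq_bigr => s _.
rewrite big_split /= mulrCA; do 2 congr (_ * _).
by apply: eq_bigr => i _; rewrite mxE.
Qed.

(** In the multilinear expansion, noninjective index tuples repeat a row and
    contribute nothing; the injective ones with the same set of values differ by
    a permutation, whose sign turns the coefficients into a minor of [A]. *)
Lemma cauchy_binet (R : comPzRingType) n k (A : 'M[R]_(k, n)) (B : 'M[R]_(n, k)) :
  \det (A *m B) =
  \sum_(j in Iplus n k) \det (colsub j A) * \det (rowsub j B).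
Proof.
rewrite det_mulmx_sum (bigID (fun f : {ffun _ -> _} => injectiveb f)) /=.
rewrite addrC big1 ?add0r => [|f]; last first.
  case/injectivePn=> i1 [i2 i12 fi12].
  by rewrite (determinant_alternate i12) ?mulr0 // => l; rewrite !mxE fi12.
rewrite -big_set injective_Iplus_perm (big_imset _ (@Iplus_perm_inj n k)) /=.
rewrite (eq_bigl (fun js => (js.1 \in Iplus n k) && true)) => [|js]; last first.
  by case: js => j s; rewrite in_setX in_setT.
rewrite -(pair_big (mem (Iplus n k)) xpredT (fun j s =>
  (\prod_i A i (comp_perm (j, s) i)) * \det (rowsub (comp_perm (j, s)) B))) /=.
apply: eq_bigr => j jI; rewrite [X in X * _]/determinant mulr_suml.
apply: eq_bigr => s _.
have -> : rowsub (comp_perm (j, s)) B = perm_mx s *m rowsub j B.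
  by rewrite -row_permE; apply/matrixP => a b; rewrite !mxE ffunE.
rewrite det_mulmx det_perm mulrCA mulrA; congr (_ * _ * _).
by apply: eq_bigr => i _; rewrite !mxE ffunE.
Qed.

(** * Determinants of moment matrices *)

(** The Hankel matrix of moments of the discrete measure giving mass [mu i] to
    the point [x i]: the matrix, in the monomial basis, of the bilinear form
    integrating the product of two polynomials of degree below [k]. *)
Definition moment_mx (R : comPzRingType) n k (mu x : 'I_n -> R) : 'M[R]_k :=
  \matrix_(a, b) \sum_(i < n) mu i * x i ^+ (a + b).

(** The matrix factors as W D W^T with W a Vandermonde matrix and D the diagonal
    matrix of masses, so Cauchy-Binet produces the squared Vandermonde
    determinants. *)
Lemma det_moment_mx (R : rcfType) n k (mu x : 'I_n -> R) :
  \det (moment_mx k mu x) =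
  \sum_(j in Iplus n k)
     (\prod_(l < k) mu (j l)) * vandermonde (fun l => x (j l)) ^+ 2.
Proof.
pose W : 'M[R]_(k, n) := Vandermonde k (\row_i x i).
have -> : moment_mx k mu x = W *m diag_mx (\row_i mu i) *m W^T.
  apply/matrixP => a b; rewrite mul_mx_diag !mxE; apply: eq_bigr => i _.
  by rewrite !mxE exprD; ring.
rewrite cauchy_binet; apply: eq_bigr => j _.
have detW : \det (colsub j W) = vandermonde (fun l => x (j l)).
  transitivity (\det (Vandermonde k (\row_l x (j l)))).
    by congr (\det _); apply/matrixP => a b; rewrite !mxE.
  rewrite det_Vandermonde; apply: eq_bigr => q _.
  by apply: eq_bigr => m _; rewrite !mxE.
have -> : colsub j (W *m diag_mx (\row_i mu i)) =
          colsub j W *m diag_mx (\row_l mu (j l)).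
  by apply/matrixP => a b; rewrite !mul_mx_diag !mxE.
have -> : rowsub j W^T = (colsub j W)^T by apply/matrixP => a b; rewrite !mxE.
rewrite det_mulmx det_diag det_tr detW.
under eq_bigr do rewrite mxE.
ring.
Qed.

(** The block matrix with rows (1, r) and (c, I) factors both as
    block lower times block upper triangular and the other way round; comparing their determinants gives the formula. *)
Lemma det_sub_mul_col_row (R : comNzRingType) k (c : 'cV[R]_k) (r : 'rV[R]_k) :
  \det (1%:M - c *m r) = 1 - (r *m c) 0 0.
Proof.
pose L := block_mx (1%:M : 'M[R]_1) r c (1%:M : 'M[R]_k).
have E1 : L = block_mx 1%:M 0 c 1%:M *m block_mx 1%:M r 0 (1%:M - c *m r).
  by rewrite mulmx_block !mul1mx !mulmx1 !mul0mx ?mulmx0 !addr0 addrC subrK.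
have E2 : L = block_mx (1%:M - r *m c) r 0 1%:M *m block_mx 1%:M 0 c 1%:M.
  by rewrite mulmx_block !mul1mx !mulmx1 !mul0mx !mulmx0 !add0r subrK.
move: (congr1 determinant E1); rewrite E2 !det_mulmx !det_ublock !det_lblock.
by rewrite !det1 !mul1r !mulr1 => <-; rewrite det_mx11 !mxE.
Qed.

(** x^(b+1) - t^(b+1) is (x - t) times a polynomial in x that is monic of degree
    b, so the matrix is the moment matrix with masses mu (x - t) times a
    unitriangular change of basis. *)
Lemma det_divided_difference (R : comNzRingType) n k (mu x : 'I_n -> R) (t : R) :
  \det (\matrix_(a < k, b < k)
     \sum_(i < n) mu i * x i ^+ a * (x i ^+ b.+1 - t ^+ b.+1)) =
  \det (moment_mx k (fun i => mu i * (x i - t)) x).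
Proof.
(* Column b holds the coefficients of (x^(b+1) - t^(b+1)) / (x - t). *)
pose T : 'M[R]_k := \matrix_(m, b) if (m <= b)%N then t ^+ (b - m) else 0.
have detT : \det T = 1.
  rewrite -det_tr det_trig.
    by rewrite big1 // => i _; rewrite !mxE leqnn subnn expr0.
  by apply/is_trig_mxP => a b ab; rewrite !mxE leqNgt ab.
rewrite -[RHS]mulr1 -detT -det_mulmx; congr (\det _); apply/matrixP => a b.
rewrite !mxE; under [RHS]eq_bigr do rewrite !mxE mulr_suml.
rewrite exchange_big /=; apply: eq_bigr => i _.
rewrite subrXX.
transitivity (\sum_(m < k | (m < b.+1)%N)
  mu i * x i ^+ a * ((x i - t) * (x i ^+ m * t ^+ (b - m)))); last first.
  rewrite big_mkcond; apply: eq_bigr => m _; rewrite ltnS.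
  by case: ifP => _; rewrite ?mulr0 // exprD; ring.
rewrite -!mulr_sumr; congr (_ * (_ * _)).
rewrite (big_ord_narrow (ltn_ord b)) /= (reindex_inj rev_ord_inj) /=.
apply: eq_bigr => m _.
by congr (x i ^+ _ * t ^+ _); have := ltn_ord m; lia.
Qed.

(** The hypothesis says that Q(t) = 1 - t P(t) is orthogonal, for the measure
    [mu], to all polynomials of degree below [k]. It reads M c = h, with c the
    coefficients of P, M the moment matrix with masses mu x, and h the vector of
    moments of [mu]. With r = (t, ..., t^k) one has r c = t P(t), hence
    Q(t) det M = det (1 - c r) det M = det (M - h r), and M - h r is the matrix
    of divided differences. *)
Lemma residual_mul_det (R : comNzRingType) n k (mu x : 'I_n -> R)
    (P : {poly R}) (t : R) :
  (size P <= k)%N ->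
  (forall a : 'I_k, \sum_(i < n) mu i * x i ^+ a * (1 - x i * P.[x i]) = 0) ->
  (1 - t * P.[t]) * \det (moment_mx k (fun i => mu i * x i) x) =
  \det (moment_mx k (fun i => mu i * (x i - t)) x).
Proof.
move=> szP normal.
pose M := moment_mx k (fun i => mu i * x i) x.
pose c : 'cV[R]_k := \col_b P`_b.
pose r : 'rV[R]_k := \row_b t ^+ b.+1.
have rc : t * P.[t] = (r *m c) 0 0.
  rewrite mxE (horner_coef_wide _ szP) mulr_sumr; apply: eq_bigr => b _.
  by rewrite !mxE exprS; ring.
have Mc a : (M *m c) a 0 = \sum_(i < n) mu i * x i ^+ a.
  have /eqP := normal a; under eq_bigr do rewrite mulrBr mulr1.
  rewrite sumrB subr_eq0 => /eqP ->.
  rewrite mxE; under eq_bigr do rewrite !mxE mulr_suml.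
  rewrite exchange_big; apply: eq_bigr => i _ /=.
  rewrite (horner_coef_wide _ szP) !mulr_sumr; apply: eq_bigr => b _.
  by rewrite exprD; ring.
rewrite rc -det_sub_mul_col_row mulrC -det_mulmx mulmxBr mulmx1 mulmxA.
rewrite -det_divided_difference; congr (\det _); apply/matrixP => a b.
rewrite !mxE big_ord1 Mc !mxE mulr_suml -sumrB; apply: eq_bigr => i _.
by rewrite exprD !exprS; ring.
Qed.

(** The bilinear form at (S, S) is the integral of S^2. Hence, for nonnegative
    masses, a kernel vector of a moment matrix is a polynomial that vanishes
    wherever the mass is positive. *)
Lemma moment_mx_quadratic (R : rcfType) n k (mu x : 'I_n -> R) (c : 'rV[R]_k) :
  (c *m moment_mx k mu x *m c^T) 0 0 = \sum_(i < n) mu i * (rVpoly c).[x i] ^+ 2.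
Proof.
have cx i : (rVpoly c).[x i] = \sum_(b < k) c 0 b * x i ^+ b.
  rewrite (@horner_coef_wide _ k) ?size_poly //.
  by apply: eq_bigr => b _; rewrite coef_rVpoly_ord.
rewrite mxE; under eq_bigr do rewrite !mxE mulr_suml.
rewrite exchange_big /=.
transitivity (\sum_(i < n) \sum_(a < k)
    mu i * (c 0 a * x i ^+ a * (rVpoly c).[x i])); last first.
  by apply: eq_bigr => i _; rewrite -mulr_sumr -mulr_suml -cx -expr2.
rewrite [RHS]exchange_big /=; apply: eq_bigr => a _.
under [RHS]eq_bigr => i _ do rewrite cx !mulr_sumr.
rewrite [RHS]exchange_big /=; apply: eq_bigr => b _.
rewrite !mxE mulr_sumr mulr_suml; apply: eq_bigr => i _.
by rewrite exprD; ring.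
Qed.

(** * Least squares and the spectral form of the objective *)

(** Along the line P + s S the loss is a quadratic in s with linear coefficient
    -2 b, where b is the sum in the conclusion; minimality at s = 0 forces
    b = 0. *)
Lemma least_squares_normal (R : rcfType) n k (w x : 'I_n -> R) (P S : {poly R}) :
  let loss (P : {poly R}) := \sum_(i < n) w i * (1 - x i * P.[x i]) ^+ 2 in
  (forall i, 0 <= w i) ->
  (size P <= k)%N ->
  (forall P' : {poly R}, (size P' <= k)%N -> loss P <= loss P') ->
  (size S <= k)%N ->
  \sum_(i < n) w i * x i * S.[x i] * (1 - x i * P.[x i]) = 0.
Proof.
move=> loss w_ge0 szP minP szS.
set b := (X in X = 0).
pose a := \sum_(i < n) w i * (x i * S.[x i]) ^+ 2.
have a_ge0 : 0 <= a.
  by apply: sumr_ge0 => i _; apply: mulr_ge0 => //; apply: sqr_ge0.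
have lossE s : loss (P + s *: S) = loss P - s * b *+ 2 + s ^+ 2 * a.
  rewrite /loss /a /b -mulrnAr -sumrMnl !mulr_sumr -sumrN -!big_split /=.
  by apply: eq_bigr => i _; rewrite hornerD hornerZ; ring.
(* When a > 0 the minimizing step is b / a; adding 1 keeps the step defined for
   a = 0 and it still decreases the loss unless b = 0. *)
pose s := b / (a + 1).
have sz : (size (P + s *: S)%R <= k)%N.
  apply: leq_trans (size_polyD _ _) _; rewrite geq_max szP.
  exact: leq_trans (size_scale_leq _ _) szS.
have bE : b = s * (a + 1) by rewrite divfK // gt_eqF //; lra.
have h : s ^+ 2 * (a + 2) <= 0.
  by have := minP _ sz; rewrite lossE bE; lra.
have s0 : s ^+ 2 = 0.
  by have := sqr_ge0 s; nra.
by move/eqP: s0; rewrite bE sqrf_eq0 => /eqP ->; rewrite mul0r.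
Qed.

Lemma horner_mx_eigenvector (R : comNzRingType) p' (G : 'M[R]_p'.+1)
    (z : 'cV[R]_p'.+1) (a : R) (P : {poly R}) :
  G *m z = a *: z -> horner_mx G P *m z = P.[a] *: z.
Proof.
move=> Gz; elim/poly_ind: P => [|P c IH].
  by rewrite rmorph0 mul0mx horner0 scale0r.
rewrite rmorphD rmorphM /= horner_mx_X horner_mx_C mulmxDl -mulmxA Gz.
by rewrite -scalemxAr IH scalerA mul_scalar_mx -scalerDl hornerMXaddC mulrC.
Qed.

Lemma horner_mx_mulmx_col (R : comNzRingType) p' (G : 'M[R]_p'.+1)
    (y : 'cV[R]_p'.+1) k (P : {poly R}) :
  (size P <= k)%N ->
  horner_mx G P *m y = \sum_(m < k) P`_m *: (G ^+ m *m y).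
Proof.
move=> szP.
have PE : P = \sum_(m < k) P`_m *: 'X^m.
  rewrite -(poly_def k (fun m => P`_m)).
  apply/polyP => m; rewrite coef_poly; case: ltnP => // km.
  by rewrite nth_default // (leq_trans szP).
rewrite [in LHS]PE raddf_sum mulmx_suml; apply: eq_bigr => m _.
by rewrite /= linearZ /= rmorphXn /= horner_mx_X scalemxAl.
Qed.

Lemma dotvC (R : rcfType) m (x y : 'cV[R]_m) : dotv x y = dotv y x.
Proof. by rewrite /dotv !mxE; apply: eq_bigr => i _; rewrite !mxE mulrC. Qed.

Lemma dotv_suml (R : rcfType) m I (r : seq I) (F : I -> 'cV[R]_m) (y : 'cV[R]_m) :
  dotv (\sum_(i <- r) F i) y = \sum_(i <- r) dotv (F i) y.
Proof. by rewrite /dotv linear_sum mulmx_suml summxE. Qed.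

Lemma dotvZl (R : rcfType) m a (x y : 'cV[R]_m) : dotv (a *: x) y = a * dotv x y.
Proof. by rewrite /dotv linearZ /= -scalemxAl mxE. Qed.

Lemma dotv_mulmxl (R : rcfType) m p (A : 'M[R]_(m, p)) (x : 'cV[R]_p) (y : 'cV[R]_m) :
  dotv (A *m x) y = dotv x (A^T *m y).
Proof. by rewrite /dotv trmx_mul mulmxA. Qed.

Lemma dotv_ge0 (R : rcfType) m (x : 'cV[R]_m) : 0 <= dotv x x.
Proof.
by rewrite /dotv mxE; apply: sumr_ge0 => i _; rewrite !mxE -expr2 sqr_ge0.
Qed.

Lemma orthonormal_dotv (R : rcfType) m (e : 'I_m -> 'cV[R]_m) (c : 'I_m -> R) i :
  orthonormal_basis e -> dotv (\sum_j c j *: e j) (e i) = c i.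
Proof.
move=> [eij _]; rewrite dotv_suml (bigD1 i) //= dotvZl eij eqxx mulr1.
by rewrite big1 ?addr0 // => j /negbTE ji; rewrite dotvZl eij ji mulr0.
Qed.

(** The matrix U with columns [e i] satisfies U^T U = 1, hence U U^T = 1 since U
    is square, and the expansion is x = U (U^T x). *)
Lemma orthonormal_expand (R : rcfType) m (e : 'I_m -> 'cV[R]_m) (x : 'cV[R]_m) :
  orthonormal_basis e -> x = \sum_i dotv x (e i) *: e i.
Proof.
move=> [orth _]; pose U : 'M[R]_m := \matrix_(a, i) e i a 0.
have UTU : U^T *m U = 1%:M.
  apply/matrixP => i j; rewrite mxE [RHS]mxE -orth /dotv mxE.
  by apply: eq_bigr => a _; rewrite !mxE.
rewrite -[LHS]mul1mx -(mulmx1C UTU) -mulmxA.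
apply/colP => a; rewrite mxE summxE; apply: eq_bigr => i _.
rewrite !mxE mulrC; congr (_ * _).
by rewrite /dotv mxE; apply: eq_bigr => b _; rewrite !mxE mulrC.
Qed.

Lemma enorm_orthonormal (R : rcfType) m (e : 'I_m -> 'cV[R]_m) (c : 'I_m -> R) :
  orthonormal_basis e -> enorm (\sum_j c j *: e j) ^+ 2 = \sum_j c j ^+ 2.
Proof.
move=> onb; rewrite sqr_sqrtr ?dotv_ge0 // dotv_suml; apply: eq_bigr => i _.
by rewrite dotvZl dotvC orthonormal_dotv.
Qed.

(** Each X^T u_i is an eigenvector of X^T X for the eigenvalue lambda_i, so a
    polynomial in X^T X acts on it as a scalar. *)
Lemma krylov_horner_spectral (R : rcfType) n p' (X : 'M[R]_(n, p'.+1))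
    (Y : 'cV[R]_n) (u : 'I_n -> 'cV[R]_n) (lambda : 'I_n -> R) (P : {poly R}) :
  orthonormal_basis u ->
  (forall i, X *m (X^T *m u i) = lambda i *: u i) ->
  horner_mx (X^T *m X) P *m (X^T *m Y) =
  \sum_i (dotv Y (u i) * P.[lambda i]) *: (X^T *m u i).
Proof.
move=> onb eig; rewrite {1}(orthonormal_expand Y onb) !mulmx_sumr.
apply: eq_bigr => i _; rewrite -!scalemxAr -scalerA; congr (_ *: _).
by apply: horner_mx_eigenvector; rewrite -mulmxA eig -scalemxAr.
Qed.

(** In the basis [u] the fitting problem becomes weighted polynomial least
    squares at the points lambda_i, with weights the squared coordinates of
    [Y]. *)
Lemma pls_objective_spectral (R : rcfType) n p' (X : 'M[R]_(n, p'.+1))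
    (Y : 'cV[R]_n) (u : 'I_n -> 'cV[R]_n) (lambda : 'I_n -> R) (P : {poly R}) :
  orthonormal_basis u ->
  (forall i, X *m (X^T *m u i) = lambda i *: u i) ->
  pls_objective X Y P =
  \sum_i dotv Y (u i) ^+ 2 * (1 - lambda i * P.[lambda i]) ^+ 2.
Proof.
move=> onb eig; rewrite /pls_objective (krylov_horner_spectral _ _ onb eig).
rewrite {1}(orthonormal_expand Y onb) mulmx_sumr -sumrB.
transitivity (enorm (\sum_i
    (dotv Y (u i) * (1 - lambda i * P.[lambda i])) *: u i) ^+ 2).
  congr (enorm _ ^+ 2); apply: eq_bigr => i _.
  by rewrite -scalemxAr eig scalerA -scalerBl; congr (_ *: _); ring.
by rewrite enorm_orthonormal //; apply: eq_bigr => i _; rewrite exprMn.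
Qed.

(** This is where the dimension of the Krylov space enters: a kernel vector of
    the matrix is a polynomial S of degree below [k] with
    S(X^T X) X^T Y = 0, that is a linear relation between the Krylov vectors. *)
Lemma krylov_moment_det_neq0 (R : rcfType) n p' (X : 'M[R]_(n, p'.+1))
    (Y : 'cV[R]_n) (u : 'I_n -> 'cV[R]_n) (lambda : 'I_n -> R) k :
  orthonormal_basis u ->
  (forall i, X *m (X^T *m u i) = lambda i *: u i) ->
  (forall i, 0 < lambda i) ->
  \dim (krylov X Y k) = k ->
  \det (moment_mx k (fun i => dotv Y (u i) ^+ 2 * lambda i ^+ 2) lambda) != 0.
Proof.
move=> onb eig lambda_gt0 dimK; apply/negP => /det0P[c c_neq0 cM0].
pose S := rVpoly c.
have YS0 i : dotv Y (u i) * S.[lambda i] = 0.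
  have := moment_mx_quadratic (fun i => dotv Y (u i) ^+ 2 * lambda i ^+ 2) lambda c.
  rewrite cM0 mul0mx mxE => /esym/eqP; rewrite psumr_eq0 => [/allP/(_ i)|j _].
    rewrite mem_index_enum => /(_ isT) /=.
    rewrite mulrAC -exprMn mulf_eq0 !expf_eq0 /= (gt_eqF (lambda_gt0 i)) orbF.
    by move/eqP.
  by rewrite -exprMn mulr_ge0 ?sqr_ge0.
have freeK : free (map_tuple (fun m => (X^T *m X) ^+ m *m (X^T *m Y))
                             (iota_tuple k 0)).
  by rewrite /free /= size_map size_iota; apply/eqP.
move/eqP: c_neq0; apply; apply/rowP => m; rewrite [RHS]mxE.
apply: (elimT freeP freeK (fun m => c 0 m)).
have := horner_mx_mulmx_col (X^T *m X) (X^T *m Y) (size_poly k _ : size S <= k)%N.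
rewrite (krylov_horner_spectral _ _ onb eig) big1 => [E|i _]; last first.
  by rewrite YS0 scale0r.
rewrite [RHS]E; apply: eq_bigr => b _.
by rewrite coef_rVpoly_ord (nth_map 0%N) ?size_iota // nth_iota.
Qed.

(** * The residual polynomial at the eigenvalues *)

Theorem theorem4p1 (R : rcfType) (n p' : nat)
    (n_gt0 : (0 < n)%N) (le_np : (n <= p'.+1)%N)
    (X : 'M[R]_(n, p'.+1)) (beta : 'cV[R]_(p'.+1)) (eps Y : 'cV[R]_n)
    (Y_def : Y = X *m beta + eps)
    (X_rank : \rank X = n)
    (lambda : 'I_n -> R)
    (lambda_eig : char_poly (X *m X^T) = \prod_(i < n) ('X - (lambda i)%:P))
    (lambda_noninc : forall i j : 'I_n, (i <= j)%N -> lambda j <= lambda i)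
    (lambda_gt0 : forall i : 'I_n, 0 < lambda i)
    (u : 'I_n -> 'cV[R]_n) (v : 'I_p'.+1 -> 'cV[R]_(p'.+1))
    (u_onb : orthonormal_basis u) (v_onb : orthonormal_basis v)
    (Xv : forall i : 'I_n,
       X *m v (widen_ord le_np i) = Num.sqrt (lambda i) *: u i)
    (XTu : forall i : 'I_n,
       X^T *m u i = Num.sqrt (lambda i) *: v (widen_ord le_np i))
    (Xv0 : forall i : 'I_p'.+1, (n <= i)%N -> X *m v i = 0)
    (k : nat) (k_bounds : (1 <= k <= n)%N)
    (krylov_dim : \dim (krylov X Y k) = k)
    (Phat : {poly R}) (Phat_min : is_pls_poly X Y k Phat) :
  let betat := fun i : 'I_n => dotv beta (v (widen_ord le_np i)) in
  let epst := fun i : 'I_n => dotv eps (u i) in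
  let p := fun i : 'I_n => dotv (X *m beta) (u i) in
  let phat := fun i : 'I_n => p i + epst i in
  (forall i : 'I_n, p i = Num.sqrt (lambda i) * betat i) /\
  (forall i : 'I_n,
     (residual_poly Phat).[lambda i] =
     \sum_(j in Iplus n k)
        (pls_weight phat lambda j /
         \sum_(j' in Iplus n k) pls_weight phat lambda j') *
        \prod_(l < k) (1 - lambda i / lambda (j l))).
Proof.
move=> betat epst p phat.
have phatE i : phat i = dotv Y (u i) by rewrite Y_def /dotv linearD mulmxDl mxE.
have eig i : X *m (X^T *m u i) = lambda i *: u i.
  by rewrite XTu -scalemxAr Xv scalerA -expr2 sqr_sqrtr // ltW.
split=> i.
  by rewrite /p dotv_mulmxl XTu dotvC dotvZl dotvC.
have [szP minP] := Phat_min.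
pose w i := phat i ^+ 2.
have normal (a : 'I_k) :
  \sum_(i < n) w i * lambda i * lambda i ^+ a * (1 - lambda i * Phat.[lambda i]) = 0.
  under eq_bigr do rewrite -hornerXn.
  apply: (@least_squares_normal _ _ k w lambda) => // [j|P' szP'|].
  - exact: sqr_ge0.
  - have := minP _ szP'; rewrite !(pls_objective_spectral _ _ u_onb eig).
    by under eq_bigr do rewrite -phatE; under [X in _ <= X]eq_bigr do rewrite -phatE.
  - by rewrite size_polyXn.
(* From lambda (lambda - t) = lambda^2 (1 - t / lambda) in each factor. *)
have wE (j : {ffun 'I_k -> 'I_n}) t :
  (\prod_(l < k) (w (j l) * lambda (j l) * (lambda (j l) - t))) *
    vandermonde (fun l => lambda (j l)) ^+ 2 =
  pls_weight phat lambda j * \prod_(l < k) (1 - t / lambda (j l)).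
  rewrite /pls_weight mulrAC -!big_split /=; congr (_ * _).
  apply: eq_bigr => l _; rewrite /w; field.
  by rewrite gt_eqF.
have detM : \det (moment_mx k (fun i => w i * lambda i * lambda i) lambda) =
            \sum_(j in Iplus n k) pls_weight phat lambda j.
  rewrite det_moment_mx; apply: eq_bigr => j _.
  rewrite /pls_weight -big_split /=; congr (_ * _).
  by apply: eq_bigr => l _; rewrite -mulrA.
have detM_neq0 : \sum_(j in Iplus n k) pls_weight phat lambda j != 0.
  have := krylov_moment_det_neq0 u_onb eig lambda_gt0 krylov_dim.
  rewrite -detM; congr (\det _ != 0); apply/matrixP => a b.
  by rewrite !mxE; apply: eq_bigr => l _; rewrite /w phatE -mulrA.
rewrite /residual_poly !hornerE.
apply: (mulIf detM_neq0).
rewrite -{1}detM (residual_mul_det (lambda i) szP normal) det_moment_mx mulr_suml.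
apply: eq_bigr => j _; by rewrite wE [RHS]mulrAC divfK.
Qed.
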